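(* Let $K$ be a number field and let $\gamma\in \mathrm{GL}(2,K)$ be a regular elliptic element whose trace $\tau$ and determinant $\det(\gamma)$ lie in $\mathcal O_K$. For a (nonzero) ideal $I$ of $\mathcal O_K$ the following are equivalent: (1) $I$ divides $S_\gamma$. (2) $I^2$ divides $\tau^2-4\det(\gamma)$, and for each prime $\mathfrak q$ of $\mathcal O_K$ above $2$, $$\frac{\tau^2-4\det(\gamma)}{\pi_{\mathfrak q}^{2\,\mathrm{val}_{\mathfrak q}(I)}}$$ is congruent to a square modulo $4\mathcal O_{K_{\mathfrak q}}$, where $\pi_{\mathfrak q}$ is a uniformizer of $\mathcal O_{K_{\mathfrak q}}$.
   Context: $\mathcal O_K$ is the ring of integers of $K$; for a prime $\mathfrak q$ of $\mathcal O_K$, $K_{\mathfrak q}$ is the completion and $\mathcal O_{K_{\mathfrak q}}$ its ring of integers. An element $\gamma\in\mathrm{GL}(2,K)$ is regular elliptic if its characteristic polynomial $X^2-\tau X+\det(\gamma)$ is irreducible over $K$. $K_\gamma$ is the quadratic extension of $K$ obtained by adjoining a root of this polynomial. $S_\gamma$ is the ideal of $\mathcal O_K$ defined by $S_\gamma^2\cdot\mathrm{Disc}(K_\gamma/K)=(\tau^2-4\det(\gamma))$, where $\mathrm{Disc}(K_\gamma/K)$ is the relative discriminant ideal. *)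

(* Defs.v *)
From HB Require Import structures.
From mathcomp Require Import all_boot all_order all_algebra all_field.
From mathcomp Require Import boolp classical_sets.

Set Implicit Arguments.
Unset Strict Implicit.
Unset Printing Implicit Defensive.

Import Order.TTheory GRing.Theory Num.Theory.
Local Open Scope classical_set_scope.
Local Open Scope ring_scope.

Section RingOfIntegers.
Variable F : fieldType.

Definition int_pred : {pred F} := fun x => `[< integralOver (intr : int -> F) x >].

Lemma int_predP x : reflect (integralOver (intr : int -> F) x) (x \in int_pred).
Proof. exact: asboolP. Qed.

Lemma int_pred_subring : subring_closed int_pred.
Proof.
split; first exact/int_predP/integral1.
  by move=> x y /int_predP ix /int_predP iy; apply/int_predP/integral_sub.
by move=> x y /int_predP ix /int_predP iy; apply/int_predP/integral_mul.
Qed.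

HB.instance Definition _ := GRing.isSubringClosed.Build F int_pred int_pred_subring.

(* The elements of F integral over Z. For a number field, and for a finite    *)
(* extension L of a number field, this is the ring of integers.               *)
Record ringInt := RingInt { ringInt_val : F; _ : ringInt_val \in int_pred }.

HB.instance Definition _ := [isSub for ringInt_val].
HB.instance Definition _ := [Choice of ringInt by <:].
HB.instance Definition _ := [SubChoice_isSubComNzRing of ringInt by <:].

End RingOfIntegers.

Arguments int_pred F : clear implicits.

Section Ideals.
Variable R : comNzRingType.
Implicit Types I J q : set R.

(* idealr_closed from ring_quotient only covers proper ideals, whereas the    *)
(* unit ideal is needed here.                                                 *)
Definition is_ideal I : Prop :=
  [/\ I 0, forall x y, I x -> I y -> I (x + y) & forall a x, I x -> I (a * x)].

Definition ideal_gen (A : set R) : set R := smallest is_ideal A.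

Definition principal (a : R) : set R := ideal_gen [set a].

Definition idealM I J : set R :=
  ideal_gen [set z | exists x y, [/\ I x, J y & z = x * y]].

Definition idealX I (n : nat) : set R := iter n (idealM I) setT.

Definition ideal_dvd I J : Prop := exists2 J', is_ideal J' & J = idealM I J'.

Record nzprime := NZPrime {
  nzprime_set :> set R;
  nzprime_ideal : is_ideal nzprime_set;
  nzprime_proper : ~ nzprime_set 1;
  nzprime_prime : forall x y,
    nzprime_set (x * y) -> nzprime_set x \/ nzprime_set y;
  nzprime_neq0 : nzprime_set <> [set 0] }.

(* The exponent of q in I; the default value 0 is only used when there is no  *)
(* largest power of q dividing I, in particular when I = 0.                   *)
Definition ideal_val q I : nat :=
  xget 0%N [set n | ideal_dvd (idealX q n) I /\ ~ ideal_dvd (idealX q n.+1) I].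

End Ideals.

Section DiscreteValuation.
Variables (F : fieldType) (v : F -> int).

(* A valuation is given by its values on nonzero elements; v 0 is irrelevant, *)
(* and val_ge treats 0 as having valuation +oo.                               *)
Definition val_ge (n : int) (x : F) : Prop := x = 0 \/ n <= v x.

Definition discrete_valuation : Prop :=
  [/\ forall x y, x != 0 -> y != 0 -> v (x * y) = v x + v y,
      forall n x y, val_ge n x -> val_ge n y -> val_ge n (x + y) &
      exists2 x, x != 0 & v x = 1].

Definition val_cauchy (u : nat -> F) : Prop :=
  forall n : int, exists N : nat, forall i j : nat,
    (N <= i)%N -> (N <= j)%N -> val_ge n (u i - u j).

Definition val_converges (u : nat -> F) (l : F) : Prop :=
  forall n : int, exists N : nat, forall i : nat,
    (N <= i)%N -> val_ge n (u i - l).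

Definition val_complete : Prop :=
  forall u, val_cauchy u -> exists l, val_converges u l.

End DiscreteValuation.

(* The completion K_q, given up to (unique) isomorphism: a complete           *)
(* discretely valued field, with normalized valuation, in which K embeds      *)
(* densely, the valuation restricting to the q-adic one. Since K is the       *)
(* fraction field of its ring of integers, it is enough to prescribe the      *)
(* valuation on the nonzero integers.                                         *)
Record completion (K : fieldType) (q : nzprime (ringInt K)) := Completion {
  cfield :> fieldType;
  cemb : {rmorphism K -> cfield};
  cval : cfield -> int;
  cval_discrete : discrete_valuation cval;
  cval_emb : forall a : ringInt K, a != 0 ->
    cval (cemb (val a)) = (ideal_val q (principal a))%:Z;
  cemb_dense : forall (x : cfield) (n : int),
    exists a : K, val_ge cval n (x - cemb a);
  cfield_complete : val_complete cval }.

Definition cint (K : fieldType) (q : nzprime (ringInt K)) (Kq : completion q) :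
  set Kq := [set x | val_ge (@cval K q Kq) 0 x].

Definition uniformizer (K : fieldType) (q : nzprime (ringInt K))
    (Kq : completion q) (x : Kq) : Prop := x != 0 /\ cval x = 1.

Section RelativeDiscriminant.
Variables (K : fieldType) (L : fieldExtType K).

Definition rel_trace (x : L) : K :=
  \tr (passmx.mxof (vbasis {:L}) (vbasis {:L}) (amull x)).

Definition basis_disc (e : (\dim {:L}).-tuple L) : K :=
  \det (\matrix_(i, j) rel_trace (tnth e i * tnth e j)).

Definition rel_disc : set (ringInt K) :=
  ideal_gen [set d | exists e : (\dim {:L}).-tuple L,
    [/\ basis_of {:L} e, {subset e <= int_pred L} & val d = basis_disc e]].

End RelativeDiscriminant.

(* L = K(theta) is the field obtained by adjoining a root of the              *)
(* characteristic polynomial of gamma.                                        *)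
Definition adjoins_eigenvalue (K : fieldType) (n : nat) (gamma : 'M[K]_n)
    (L : fieldExtType K) (theta : L) : Prop :=
  root (map_poly (in_alg L) (char_poly gamma)) theta /\ <<1; theta>>%VS = fullv.

(* Main.v *)
(* Write D = tau^2 - 4 det(gamma) and s = 2 theta - tau, so that s^2 = D. Let C *)
(* be the set of x in K for which (y + x s) / 2 is integral for some y in K,    *)
(* that is, for which D x^2 is a square mod 4. It is an O_K-module and          *)
(* Disc(K_gamma / K) = (D x^2 | x in C), so that S_gamma is the inverse of C.   *)
(* Hence I divides S_gamma iff every x with x I integral is in C. Localizing    *)
(* this at q, with val_q(x) = - val_q(I), gives the congruence mod 4 in K_q;    *)
(* conversely, if the congruences hold, the ideal of the r such that r x is in  *)
(* C contains 2 and is contained in no prime above 2, so it is the unit ideal.  *)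
(*                                                                              *)
(* Unique factorization of ideals in O_K is not needed: every ideal that must   *)
(* be inverted divides a nonzero principal ideal.                               *)

Require Import Defs.
From HB Require Import structures.
From mathcomp Require Import all_boot all_order all_algebra all_field.
From mathcomp Require Import boolp classical_sets.
From mathcomp Require Import ring zify.

Set Implicit Arguments.
Unset Strict Implicit.
Unset Printing Implicit Defensive.

Import Order.TTheory GRing.Theory Num.Theory.
Local Open Scope classical_set_scope.
Local Open Scope ring_scope.

(** With s = 2 theta - tau and s^2 = D, the trace and norm test ([int_quadP]) describes the integers
    of L through C = [two_coef s]. A basis of integers has discriminant D x^2 with x in C, and every
    nonzero x in C occurs ([rel_disc_quad]). So S^2 Disc = (D) reads S^2 C^2 = (1): S is the inverse
    of C ([conductor_mul_int], [conductor_coef_unit]), and I divides S iff the inverse of I lies in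
    C ([dvd_conductorP]).

    Membership of x in C is a congruence modulo 4, to be compared with the one in K_q.
    [two_coef_square_mod4] rescales an x of value - val_q(I) to a unit; [square_mod4_denominator]
    goes back by approximating an element of K_q in K. [square_mod4_sub_two_coef] glues the primes
    above 2. No condition arises at other primes, because integrality of D x^2 already puts 2 x in
    C. *)

(** * Ideals of a commutative ring: products, divisibility, maximal ideals, exponents *)

Section IdealArithmetic.
Variable R : comNzRingType.
Implicit Types (q I J P : set R) (a c : R).

Lemma ideal_gen_ideal (A : set R) : is_ideal (ideal_gen A).
Proof.
split=> [P [[]] //|x y Ax Ay P PA|a x Ax P PA].
- by case: (PA) => -[_ PD _] _; apply: PD; [apply: Ax|apply: Ay].
- by case: (PA) => -[_ _ PM] _; apply: PM; apply: Ax.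
Qed.

Lemma idealT : is_ideal [set: R].
Proof. by []. Qed.

Lemma idealN I x : is_ideal I -> I x -> I (- x).
Proof. by move=> [_ _ IM] Ix; rewrite -mulN1r; apply: IM. Qed.

Lemma ideal_preim I (f : R -> R) : is_ideal I -> f 0 = 0 ->
    {morph f : x y / x + y} -> (forall a x, f (a * x) = a * f x) ->
  is_ideal [set x | I (f x)].
Proof.
move=> [I0 ID IM] f0 fD fM; split=> [|x y|a x] /=; rewrite ?f0 ?fD ?fM //.
  exact: ID.
exact: IM.
Qed.

Lemma ideal_colon I a : is_ideal I -> is_ideal [set x | I (a * x)].
Proof.
by move=> idI; apply: ideal_preim => // [|x y|b x]; rewrite ?mulr0 ?mulrDr // mulrCA.
Qed.

Lemma ideal_gen_mem (A : set R) : A `<=` ideal_gen A.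
Proof. exact: sub_gen_smallest. Qed.

Lemma ideal_gen_sub (A : set R) P : is_ideal P -> A `<=` P -> ideal_gen A `<=` P.
Proof. exact: smallest_sub. Qed.

Lemma principalP a x : principal a x <-> exists r, x = a * r.
Proof.
split=> [|[r ->]]; last first.
  case: (ideal_gen_ideal [set a]) => _ _ PM; rewrite mulrC; apply: PM.
  exact: ideal_gen_mem.
apply: (@ideal_gen_sub _ [set x | exists r, x = a * r]); last first.
  by move=> _ ->; exists 1; rewrite mulr1.
split=> [|_ _ [r ->] [s ->]|b _ [r ->]].
- by exists 0; rewrite mulr0.
- by exists (r + s); rewrite mulrDr.
- by exists (b * r); rewrite mulrCA.
Qed.

Lemma principal_ideal a : is_ideal (principal a).
Proof. exact: ideal_gen_ideal. Qed.

Lemma principal_mem a : principal a a.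
Proof. exact: ideal_gen_mem. Qed.

Lemma principal_sub a I : is_ideal I -> I a -> principal a `<=` I.
Proof. by move=> idI Ia; apply: ideal_gen_sub => // _ ->. Qed.

Lemma idealM_ideal I J : is_ideal (idealM I J).
Proof. exact: ideal_gen_ideal. Qed.

Lemma idealM_mem I J x y : I x -> J y -> idealM I J (x * y).
Proof. by move=> Ix Jy; apply: ideal_gen_mem; exists x, y. Qed.

Lemma idealM_sub I J P : is_ideal P ->
  (forall x y, I x -> J y -> P (x * y)) -> idealM I J `<=` P.
Proof.
by move=> idP IJP; apply: ideal_gen_sub => // _ [x [y [Ix Jy ->]]]; apply: IJP.
Qed.

Lemma idealMC I J : idealM I J = idealM J I.
Proof.
by apply/seteqP; split; apply: idealM_sub (idealM_ideal _ _) _ => x y ? ?;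
  rewrite mulrC; apply: idealM_mem.
Qed.

Lemma idealMA I J P : idealM I (idealM J P) = idealM (idealM I J) P.
Proof.
have sub I' J' P' : idealM I' (idealM J' P') `<=` idealM (idealM I' J') P'.
  apply: idealM_sub (idealM_ideal _ _) _ => x y Ix; move: y.
  apply: idealM_sub; first exact/ideal_colon/idealM_ideal.
  by move=> y z Jy Pz /=; rewrite mulrA; do 2?apply: idealM_mem.
apply/seteqP; split=> //; rewrite idealMC (idealMC I J) (idealMC I) (idealMC J P).
exact: sub.
Qed.

Lemma idealM1 I : is_ideal I -> idealM I setT = I.
Proof.
move=> idI; apply/seteqP; split=> [|x Ix]; last first.
  by rewrite -[x]mulr1; apply: idealM_mem.
apply: idealM_sub => // x y Ix _; case: idI => _ _ IM; rewrite mulrC.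
exact: IM.
Qed.

Lemma idealM_subl I J : is_ideal I -> idealM I J `<=` I.
Proof.
move=> idI; apply: idealM_sub => // x y Ix _; case: idI => _ _ IM.
by rewrite mulrC; apply: IM.
Qed.

Lemma idealMS I I' J J' : I `<=` I' -> J `<=` J' -> idealM I J `<=` idealM I' J'.
Proof.
move=> II' JJ'; apply: idealM_sub; first exact: idealM_ideal.
by move=> x y /II' ? /JJ' ?; apply: idealM_mem.
Qed.

Lemma principal_neq0 a : a != 0 -> principal a <> [set 0].
Proof.
by move=> a0 aE; have := @principal_mem a; rewrite aE => /= /eqP; rewrite (negPf a0).
Qed.

Lemma principalM a c : idealM (principal a) (principal c) = principal (a * c).
Proof.
apply/seteqP; split; last first.
  apply: principal_sub (idealM_ideal _ _) _.
  by apply: idealM_mem; apply: principal_mem.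
apply: idealM_sub (principal_ideal _) _ => _ _ /principalP[r ->] /principalP[s ->].
by apply/principalP; exists (r * s); ring.
Qed.

Lemma ideal_dvd_sub I J : is_ideal I -> ideal_dvd I J -> J `<=` I.
Proof. by move=> idI [J' _ ->]; apply: idealM_subl. Qed.

Lemma ideal_dvd_trans I J P : ideal_dvd I J -> ideal_dvd J P -> ideal_dvd I P.
Proof.
move=> [J' _ ->] [P' _ ->]; exists (idealM J' P'); first exact: idealM_ideal.
by rewrite idealMA.
Qed.

Lemma ideal_dvd_mulr I J : is_ideal J -> ideal_dvd I (idealM I J).
Proof. by exists J. Qed.

(** This is the part of (c / a) I inside R, written without fractions. Being an ideal, it extends a
    relation [a * x = c * t] from the generators of a product of ideals to the whole product. *)
Lemma ideal_quot a c I : is_ideal I ->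
  is_ideal [set x | exists2 t, a * x = c * t & I t].
Proof.
move=> [I0 ID IM]; split=> [|x y [t tE It] [w wE Iw]|r x [t tE It]].
- by exists 0; rewrite ?mulr0.
- by exists (t + w); [rewrite !mulrDr tE wE|apply: ID].
- by exists (r * t); [rewrite mulrCA tE mulrCA|apply: IM].
Qed.

(* [I] is invertible as soon as it divides a nonzero principal ideal: then    *)
(* containment is divisibility.                                               *)
Lemma sub_ideal_dvd c I J : GRing.lreg c -> is_ideal I -> is_ideal J ->
  ideal_dvd I (principal c) -> J `<=` I -> ideal_dvd I J.
Proof.
move=> creg idI idJ [I' idI' cE] JI.
have IM1 a x : I a -> I' x -> exists t, a * x = c * t.
  by move=> Ia I'x; apply/principalP; rewrite cE; apply: idealM_mem.
have idQ : is_ideal [set t | idealM J I' (c * t)].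
  exact/ideal_colon/idealM_ideal.
(* As I I' = (c), the cofactor of I in J has to be J I' / c. *)
exists [set t | idealM J I' (c * t)] => //; apply/seteqP; split=> [x Jx|].
  have sub : idealM I I' `<=`
      [set y | exists2 t, x * y = c * t & idealM I [set t | idealM J I' (c * t)] t].
    apply: idealM_sub => [|a y Ia I'y]; first exact/ideal_quot/idealM_ideal.
    have [t tE] := IM1 x y (JI x Jx) I'y.
    exists (a * t); first by rewrite mulrCA tE mulrCA.
    by apply: idealM_mem; rewrite //= -tE; apply: idealM_mem.
  have [|t + It] := sub c; first by rewrite -cE; apply: principal_mem.
  by rewrite mulrC => /creg->.
apply: idealM_sub => // a t Ia /= Jct.
have sub : idealM J I' `<=` [set y | exists2 s, a * y = c * s & J s].
  apply: idealM_sub => [|x y Jx I'y]; first exact: ideal_quot.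
  have [r rE] := IM1 a y Ia I'y.
  by exists (r * x); [rewrite mulrCA rE; ring|case: idJ => _ _; apply].
by have [s + Js] := sub _ Jct; rewrite mulrCA => /creg->.
Qed.

Lemma idealX_ideal I n : is_ideal (idealX I n).
Proof. by case: n => [|n]; [apply: idealT|apply: idealM_ideal]. Qed.

Lemma idealX1 I : is_ideal I -> idealX I 1 = I.
Proof. exact: idealM1. Qed.

Lemma idealXS I n : idealX I n.+1 = idealM I (idealX I n).
Proof. by []. Qed.

Lemma idealX_add I m n : idealX I (m + n) = idealM (idealX I m) (idealX I n).
Proof.
elim: m => [|m IHm]; first by rewrite idealMC idealM1 //; apply: idealX_ideal.
by rewrite addSn !idealXS IHm idealMA.
Qed.

Lemma idealX_dvd I m n : (m <= n)%N -> ideal_dvd (idealX I m) (idealX I n).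
Proof.
by move=> /subnKC <-; rewrite idealX_add; apply/ideal_dvd_mulr/idealX_ideal.
Qed.

Lemma idealX_dvd_principal I c n : is_ideal I ->
  ideal_dvd I (principal c) -> ideal_dvd (idealX I n) (principal (c ^+ n)).
Proof.
move=> idI [J idJ cE]; elim: n => [|n [P idP IHn]].
  exists (principal (1 : R)); first exact: principal_ideal.
  by rewrite idealMC idealM1 //; apply: principal_ideal.
exists (idealM J P); first exact: idealM_ideal.
rewrite exprS -principalM cE IHn idealXS !idealMA; congr (idealM _ P).
by rewrite -!idealMA (idealMC J).
Qed.

Lemma maximal_ideal_exists I : is_ideal I -> ~ I 1 ->
  exists M, [/\ is_ideal M, I `<=` M, ~ M 1 &
    forall J, is_ideal J -> M `<=` J -> ~ J 1 -> J = M].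
Proof.
move=> idI I1.
pose proper J := [/\ is_ideal J, I `<=` J & ~ J 1].
(* The empty set joins the family because the empty chain has empty union; it is not maximal, since
   I is larger. *)
have [F FP Ftot|M [[M0|[idM IM M1]] Mmax]] :=
    @Zorn_bigcup R [set J | J = set0 \/ proper J].
- have [[J FJ Jprop]|F0] := pselect (exists2 J, F J & proper J); last first.
    left; apply/seteqP; split=> // x [J FJ Jx].
    by have [J0|Jprop] := FP J FJ; [rewrite J0 in Jx|case: F0; exists J].
  have Fprop P x : F P -> P x -> proper P.
    by move=> FPP Px; case: (FP P FPP) => // P0; rewrite P0 in Px.
  case: (Jprop) => -[J0 _ _] IJ _.
  right; split; first split.
  + by exists J.
  + move=> x y [P FPP Px] [Q FQ Qy].
    have [_ PD _] : is_ideal P by have [] := Fprop P x FPP Px.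
    have [_ QD _] : is_ideal Q by have [] := Fprop Q y FQ Qy.
    have [PQ|QP] := Ftot P Q FPP FQ.
      by exists Q => //; apply: QD => //; apply: PQ.
    by exists P => //; apply: PD => //; apply: QP.
  + move=> a x [P FPP Px]; exists P => //.
    by have [[_ _ PM] _ _] := Fprop P x FPP Px; apply: PM.
  + by move=> x Ix; exists J => //; apply: IJ.
  + by move=> [P FPP P1]; have [] := Fprop P 1 FPP P1.
- case: (Mmax I); last by right; split.
  by rewrite M0; split=> // /(_ 0); apply; case: idI.
exists M; split=> // J idJ MJ J1; apply: contrapT => JM.
case: (Mmax J); last by right; split=> //; apply: subset_trans MJ.
by rewrite properEneq; split=> //; apply/eqP => MJE; apply: JM.
Qed.

(** If y is not in M, the colon ideal of M by y is proper and contains M, hence equals M; it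
    contains x. *)
Lemma maximal_ideal_prime M : is_ideal M -> ~ M 1 ->
    (forall J, is_ideal J -> M `<=` J -> ~ J 1 -> J = M) ->
  forall x y, M (x * y) -> M x \/ M y.
Proof.
move=> idM M1 Mmax x y Mxy; case: (pselect (M x)) => [|Mx]; first by left.
have colon_sub : M `<=` [set t | M (y * t)].
  by move=> t Mt; case: idM => _ _; apply.
have [M1y|M1y] := pselect (M y); first by right.
have ME : [set t | M (y * t)] = M.
  by apply: Mmax => //=; [exact: ideal_colon|rewrite mulr1].
by left; rewrite -ME /= mulrC.
Qed.

Lemma nzprime_exists I : is_ideal I -> I <> [set 0] -> ~ I 1 ->
  exists q : nzprime R, I `<=` q.
Proof.
move=> idI I0 I1; have [M [idM IM M1 Mmax]] := maximal_ideal_exists idI I1.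
have M0 : M <> [set 0].
  move=> M0; apply: I0; apply/seteqP; split; first by rewrite -M0.
  by move=> _ ->; case: idI.
by exists (NZPrime idM M1 (maximal_ideal_prime idM M1 Mmax) M0).
Qed.

Lemma idealX2 I : is_ideal I -> idealX I 2 = idealM I I.
Proof. by move=> idI; rewrite idealXS idealX1. Qed.

Lemma idealM_sqr I J : is_ideal I -> is_ideal J ->
  idealX (idealM I J) 2 = idealM (idealX I 2) (idealX J 2).
Proof.
move=> idI idJ; rewrite !idealX2 //; last exact: idealM_ideal.
by rewrite !idealMA; congr (idealM _ J); rewrite -!idealMA (idealMC J).
Qed.

Lemma ideal_val_unique q I n : ideal_dvd (idealX q n) I ->
  ~ ideal_dvd (idealX q n.+1) I -> ideal_val q I = n.
Proof.
move=> dn ndn; apply: xget_unique => [|m [dm ndm]]; first by split.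
apply/eqP; rewrite eqn_leq; apply/andP; split; rewrite leqNgt; apply/negP => lt.
  by apply: ndn; apply: ideal_dvd_trans (idealX_dvd q lt) dm.
by apply: ndm; apply: ideal_dvd_trans (idealX_dvd q lt) dn.
Qed.

(** One failing exponent [n] excludes the default value: descending from [n] meets the largest
    exponent that divides. *)
Lemma ideal_valP q I n : ideal_dvd (idealX q 0) I -> ~ ideal_dvd (idealX q n) I ->
  ideal_dvd (idealX q (ideal_val q I)) I /\
  ~ ideal_dvd (idealX q (ideal_val q I).+1) I.
Proof.
elim: n => [//|n IHn] d0 ndn.
have [dn|] := pselect (ideal_dvd (idealX q n) I); last exact: IHn.
by rewrite (ideal_val_unique dn ndn).
Qed.

End IdealArithmetic.

(** * Elements of a field integral over the integers *)

Section IntegralElements.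
Variable F : fieldType.
Implicit Types (x : F) (p : {poly F}).

Lemma int_pred_root p x : p \is monic -> p \is a polyOver (int_pred F) ->
  root p x -> x \in int_pred F.
Proof.
move=> mp /polyOverP pO px; apply/int_predP.
by apply: integral_root_monic mp px _; apply/integral_poly => i; apply/int_predP.
Qed.

Lemma int_pred_sqr x : x ^+ 2 \in int_pred F -> x \in int_pred F.
Proof.
move=> x2; apply: (@int_pred_root ('X^2 - (x ^+ 2)%:P)).
- exact: monicXnsubC.
- by rewrite polyOverXnsubC.
- by rewrite /root !hornerE subrr.
Qed.

(** With c the leading coefficient and n the degree, multiplying p(x) = 0 by c^(n-1) gives a monic
    equation for c x with integral coefficients. *)
Lemma lead_coef_mul_int p x : p \is a polyOver (int_pred F) -> root p x ->
  lead_coef p * x \in int_pred F.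
Proof.
have [->|p0] := eqVneq p 0; first by move=> _ _; rewrite lead_coef0 mul0r rpred0.
move=> /polyOverP pO px; pose n := (size p).-1; set c := lead_coef p.
have sp : size p = n.+1 by rewrite prednK // size_poly_gt0.
pose r := \poly_(i < n) (p`_i * c ^+ (n.-1 - i)).
have n0 : (0 < n)%N.
  case En: n => //; have sp1 : (size p <= 1)%N by rewrite sp En.
  by move: px; rewrite (size1_polyC sp1) rootC -polyC_eq0 -size1_polyC ?(negPf p0).
have sr : (size r < size ('X^n : {poly F}))%N.
  by rewrite size_polyXn ltnS size_poly.
apply: (@int_pred_root ('X^n + r)).
- by rewrite monicE lead_coefDl // lead_coefXn.
- rewrite rpredD ?polyOverXn //; apply/polyOverP => i.
  by rewrite coef_poly; case: ifP => _; rewrite ?rpred0 // rpredM ?rpredX ?pO.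
- rewrite /root hornerD hornerXn /r horner_poly.
  suff -> : (c * x) ^+ n + \sum_(i < n) p`_i * c ^+ (n.-1 - i) * (c * x) ^+ i =
      c ^+ n.-1 * p.[x] by rewrite (eqP px) mulr0.
  rewrite horner_coef sp big_ord_recr /= mulrDr addrC; congr (_ + _).
    rewrite mulr_sumr; apply: eq_bigr => i _; rewrite exprMn.
    have {2}-> : n.-1 = (n.-1 - i + i)%N.
      by rewrite subnK // -ltnS prednK.
    by rewrite exprD; ring.
  rewrite exprMn -[in c ^+ n](prednK n0) exprSr -/n.
  by rewrite -/(lead_coef p) -/c mulrA.
Qed.

End IntegralElements.

(** * The ring of integers of a number field and its fractions *)

Section RingInt.
Variable K : fieldExtType rat.
Implicit Types (a b c : ringInt K) (x : K).

Lemma ringIntE x : x \in int_pred K -> exists a, val a = x.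
Proof. by move=> xO; exists (RingInt xO). Qed.

Lemma ringIntM a b : val (a * b) = val a * val b.
Proof. exact: rmorphM. Qed.

Lemma ringIntD a b : val (a + b) = val a + val b.
Proof. exact: rmorphD. Qed.

Lemma ringInt0 : val (0 : ringInt K) = 0.
Proof. exact: rmorph0. Qed.

Lemma ringInt1 : val (1 : ringInt K) = 1.
Proof. exact: rmorph1. Qed.

Lemma ringInt_val_eq0 a : (val a == 0) = (a == 0).
Proof. by rewrite -(inj_eq val_inj) raddf0. Qed.

Lemma ringInt_lreg a : a != 0 -> GRing.lreg a.
Proof.
rewrite -ringInt_val_eq0 => a0 b c /(congr1 val); rewrite !rmorphM /= => /(mulfI a0).
exact: val_inj.
Qed.

(** The minimal polynomial of x over the rationals, scaled to integer coefficients, has a leading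
    coefficient that serves as denominator. *)
Lemma ringInt_frac x : exists b c, c != 0 /\ x = val b / val c.
Proof.
have /polyOver1P[p pE] := minPolyOver 1 x.
have px : root (map_poly (in_alg K) p) x by rewrite -pE root_minPoly.
have p0 : p != 0.
  by rewrite -(map_poly_eq0 (in_alg K)) -pE -size_poly_gt0 size_minPoly.
have [q [m m0 qE]] := rat_poly_scale p.
have mK0 : in_alg K (m%:~R^-1) != 0 by rewrite fmorph_eq0 invr_eq0 intr_eq0.
have {}px : root (map_poly intr q) x.
  move: px; rewrite qE map_polyZ rootZ // -map_poly_comp.
  by rewrite (eq_map_poly (g := intr)) // => i /=; rewrite -[RHS](rmorph_int (in_alg K)).
have q0 : q != 0 by apply: contraNneq p0 => q0; rewrite qE q0 map_poly0 scaler0.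
have lead_q : lead_coef (map_poly intr q : {poly K}) = (lead_coef q)%:~R.
  rewrite lead_coef_map_eq // -[X in X != _](rmorph_int (in_alg K)) fmorph_eq0.
  by rewrite intr_eq0 lead_coef_eq0.
have cx : (lead_coef q)%:~R * x \in int_pred K.
  rewrite -lead_q; apply: lead_coef_mul_int px.
  by apply/polyOverP => i; rewrite coef_map rpred_int.
have [b bE] := ringIntE cx; exists b, (lead_coef q)%:~R.
have c0 : (lead_coef q)%:~R != 0 :> K.
  by rewrite -(rmorph_int (in_alg K)) fmorph_eq0 intr_eq0 lead_coef_eq0.
split; first by rewrite -ringInt_val_eq0 rmorph_int.
by rewrite bE rmorph_int mulrC mulKf.
Qed.

Lemma two_neq0 : 2%:R != 0 :> K.
Proof. by rewrite -(rmorph_nat (in_alg K)) fmorph_eq0 pnatr_eq0. Qed.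

End RingInt.

Lemma mulXsubC2 (R : comNzRingType) (x y : R) :
  ('X - x%:P) * ('X - y%:P) = 'X^2 - (x + y)%:P * 'X + (x * y)%:P.
Proof. by rewrite polyCD polyCM; ring. Qed.

Lemma int_pred_alg (K : fieldType) (L : fieldExtType K) (k : K) :
  (k%:A \in int_pred L) = (k \in int_pred K).
Proof.
have mapE (p : {poly int}) :
    map_poly intr p = map_poly (in_alg L) (map_poly intr p).
  rewrite -map_poly_comp; apply: eq_map_poly => i /=.
  by rewrite -(rmorph_int (in_alg L)).
by apply/int_predP/int_predP => -[p mp]; rewrite ?mapE => px; exists p => //;
  move: px; rewrite ?mapE -[k%:A]/(in_alg L k) fmorph_root.
Qed.

(** The entry (0, 1) of A^2 is A_01 tr(A) = 0, and A_01 = 0 would make D the square of A_00. The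
    size is a variable because the dimension of L equals 2 only propositionally. *)
Lemma mxtrace_sqrt_scalar (K : fieldType) n (A : 'M[K]_n) (D : K) :
  n = 2 -> (forall c, c ^+ 2 != D) -> A *m A = D%:M -> \tr A = 0.
Proof.
move=> n2; rewrite {n}n2 in A * => nsq /matrixP A2.
pose i : 'I_2 := lift ord0 ord0; have := A2 ord0 ord0; have := A2 ord0 i.
rewrite !mxE !big_ord_recl !big_ord0 /= !addr0 /mxtrace !big_ord_recl big_ord0.
rewrite mulr0n mulr1n addr0 -/i.
rewrite [A ord0 i * _]mulrC -mulrDl => /eqP; rewrite mulf_eq0 => /orP[/eqP //|/eqP ->].
by rewrite mul0r addr0 => /eqP; rewrite -expr2 (negPf (nsq _)).
Qed.

(** * Integers and discriminant of a quadratic extension *)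

Section Quadratic.
Variables (K : fieldType) (L : fieldExtType K) (s : L) (D : K).
Hypothesis two0 : 2%:R != 0 :> K.
Hypothesis sE : s ^+ 2 = D%:A.
Hypothesis D_nonsquare : forall c : K, c ^+ 2 != D.
Hypothesis quad_span : forall x : L, exists a b, x = a%:A + b *: s.
Implicit Types (a b x y : K).

Lemma four_neq0 : 4%:R != 0 :> K.
Proof. by rewrite (natrM _ 2 2) mulf_neq0 ?two0. Qed.

Lemma quad_inj a b : a%:A + b *: s = 0 -> a = 0 /\ b = 0.
Proof.
move=> ab0; suff b0 : b = 0.
  move: ab0; rewrite b0 scale0r addr0 => /eqP.
  by rewrite scaler_eq0 oner_eq0 orbF => /eqP.
apply/eqP/negPn/negP => b0; have := D_nonsquare (a / b); case/negP.
have sA : s = (- a / b)%:A.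
  apply: (scalerI b0); rewrite scalerA mulrCA mulfV // mulr1.
  by apply/eqP; rewrite scaleNr -addr_eq0 addrC ab0.
have /(fmorph_inj (in_alg L)) <- : (- a / b) ^+ 2 *: 1 = D *: 1 :> L.
  by rewrite -sE sA -[(- a / b)%:A]/(in_alg L _) -rmorphXn.
by rewrite mulNr sqrrN.
Qed.

Lemma quad_injE a b a' b' :
  a%:A + b *: s = a'%:A + b' *: s -> a = a' /\ b = b'.
Proof.
move/eqP; rewrite -subr_eq0 opprD addrACA -!scalerBl => /eqP/quad_inj[].
by move=> /eqP + /eqP; rewrite !subr_eq0 => /eqP -> /eqP.
Qed.

Lemma quadM a b a' b' : (a%:A + b *: s) * (a'%:A + b' *: s) =
  (a * a' + D * (b * b'))%:A + (a * b' + a' * b) *: s.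
Proof.
rewrite mulrDl !mulrDr -!scalerAl !mul1r -!scalerAr mulr1 -expr2 sE !scalerDl.
rewrite !scalerA -!addrA; congr (_ + _).
rewrite addrC -addrA addrCA; congr (_ + _); first by rewrite [D * _]mulrC.
by rewrite addrC [a' * b]mulrC.
Qed.

(** Evaluation of polynomials over K commutes with conjugation; the shared coordinates [u], [v] say
    so without constructing an automorphism of L. *)
Lemma quad_horner (p : {poly K}) a b : exists u v,
  (map_poly (in_alg L) p).[a%:A + b *: s] = u%:A + v *: s /\
  (map_poly (in_alg L) p).[a%:A + (- b) *: s] = u%:A + (- v) *: s.
Proof.
elim/poly_ind: p => [|p c [u [v [IH1 IH2]]]].
  by exists 0, 0; rewrite rmorph0 !horner0 oppr0 !scale0r addr0.
exists (u * a + D * (v * b) + c), (u * b + a * v).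
rewrite rmorphD rmorphM /= map_polyX map_polyC /= !hornerMXaddC IH1 IH2 !quadM.
rewrite mulrNN; split; rewrite addrAC -scalerDl //.
by rewrite !mulrN -opprD.
Qed.

Lemma int_quad_conj a b :
  a%:A + b *: s \in int_pred L -> a%:A + (- b) *: s \in int_pred L.
Proof.
move=> /int_predP[p mp]; have [u [v [pE pNE]]] := quad_horner (map_poly intr p) a b.
have mapE : map_poly intr p = map_poly (in_alg L) (map_poly intr p).
  rewrite -map_poly_comp; apply: eq_map_poly => i /=.
  by rewrite -(rmorph_int (in_alg L)).
rewrite mapE /root pE => /eqP/quad_inj[u0 v0]; apply/int_predP; exists p => //.
by rewrite mapE /root pNE u0 v0 oppr0 !scale0r addr0.
Qed.

(** The two elements of K are the trace and the norm: sum and product of conjugates, and the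
    coefficients of a monic quadratic with root a + b s. *)
Lemma int_quadP a b : a%:A + b *: s \in int_pred L <->
  2%:R * a \in int_pred K /\ a ^+ 2 - D * b ^+ 2 \in int_pred K.
Proof.
split=> [ab|[tr nm]].
  have ab' := int_quad_conj ab; rewrite -!(int_pred_alg L); split.
    suff -> : (2 * a)%:A = (a%:A + b *: s) + (a%:A + (- b) *: s) by rewrite rpredD.
    by rewrite addrACA -!scalerDl subrr scale0r addr0 mulrDl mul1r.
  suff -> : (a ^+ 2 - D * b ^+ 2)%:A = (a%:A + b *: s) * (a%:A + (- b) *: s).
    by rewrite rpredM.
  rewrite quadM; have -> : a * - b + a * b = 0 by ring.
  by rewrite scale0r addr0; congr (_ *: _); ring.
pose x := a%:A + b *: s; pose x' := a%:A + (- b) *: s.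
have xDx' : x + x' = (2%:R * a)%:A.
  by rewrite addrACA -!scalerDl subrr scale0r addr0 mulrDl mul1r.
have xMx' : x * x' = (a ^+ 2 - D * b ^+ 2)%:A.
  rewrite quadM; have -> : a * - b + a * b = 0 by ring.
  by rewrite scale0r addr0; congr (_ *: _); ring.
apply: (@int_pred_root _ (('X - x%:P) * ('X - x'%:P))).
- by rewrite monicMl ?monicXsubC.
- rewrite mulXsubC2 xDx' xMx' rpredD ?polyOverC ?int_pred_alg // rpredB ?polyOverXn //.
  by rewrite rpredM ?polyOverX ?polyOverC ?int_pred_alg.
- by rewrite rootM root_XsubC eqxx.
Qed.

(* The fractional ideal of twice the coefficients of [s] in the integers of L; *)
(* the relative discriminant turns out to be [D] times its square.             *)
Definition two_coef : set K :=
  [set x | exists y, (y / 2%:R)%:A + (x / 2%:R) *: s \in int_pred L].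

Lemma two_coefP x : two_coef x <->
  exists2 y, y \in int_pred K & (y ^+ 2 - D * x ^+ 2) / 4%:R \in int_pred K.
Proof.
have e4 y : (y / 2%:R) ^+ 2 - D * (x / 2%:R) ^+ 2 = (y ^+ 2 - D * x ^+ 2) / 4%:R.
  have -> : 4%:R = 2%:R * 2%:R :> K by ring.
  by rewrite !expr_div_n mulrA -mulrBl expr2.
split=> [[y /int_quadP]|[y yO nm]].
  by rewrite mulrC divfK // e4 => -[yO nm]; exists y.
by exists y; apply/int_quadP; rewrite mulrC divfK // e4.
Qed.

Lemma two_coefD x y : two_coef x -> two_coef y -> two_coef (x + y).
Proof.
move=> [x' xO] [y' yO]; exists (x' + y'); rewrite !mulrDl !scalerDl addrACA.
exact: rpredD.
Qed.

Lemma two_coefM r x : r \in int_pred K -> two_coef x -> two_coef (r * x).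
Proof.
move=> rO [y xO]; exists (r * y); rewrite -!mulrA -!(scalerA r) -scalerDr.
set w := _ + _; have -> : r *: w = r%:A * w by rewrite -scalerAl mul1r.
by rewrite rpredM ?int_pred_alg.
Qed.

Lemma two_coef_int x : two_coef x -> D * x ^+ 2 \in int_pred K.
Proof.
move=> /two_coefP[y yO nm].
have -> : D * x ^+ 2 = y ^+ 2 - 4%:R * ((y ^+ 2 - D * x ^+ 2) / 4%:R).
  rewrite [4%:R * _]mulrC divfK; first by ring.
  exact: four_neq0.
by rewrite rpredB ?rpredX // rpredM // rpred_nat.
Qed.

(** The conjugate of the first element times the second is integral, and its coefficient of s is a
    b' - a' b. *)
Lemma two_coef_wedge a b a' b' :
    a%:A + b *: s \in int_pred L -> a'%:A + b' *: s \in int_pred L ->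
  two_coef (2%:R * (a * b' - a' * b)).
Proof.
move=> e1 e2; exists (2%:R * (a * a' + D * (- b * b'))).
rewrite ![2%:R * _]mulrC !mulfK //.
have -> : a * b' - a' * b = a * b' + a' * - b by ring.
by rewrite -quadM rpredM // int_quad_conj.
Qed.

Lemma quad_basis a b : b != 0 -> basis_of {:L} [:: 1; a%:A + b *: s].
Proof.
move=> b0; apply/andP; split.
  rewrite eqEsubv subvf; apply/subvP => v _; have [c [d ->]] := quad_span v.
  rewrite span_cons span_seq1.
  have -> : c%:A + d *: s = (c - d / b * a)%:A + (d / b) *: (a%:A + b *: s).
    by rewrite scalerBl scalerDr !scalerA divfK // addrA subrK.
  by rewrite memv_add // memvZ // memv_line.
rewrite free_cons seq1_free span_seq1; apply/andP; split.
  apply/vlineP => -[k]; rewrite scalerDr !scalerA => kE.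
  have [|k1 /eqP] := @quad_injE 1 0 (k * a) (k * b).
    by rewrite scale1r scale0r addr0.
  rewrite eq_sym mulf_eq0 (negPf b0) orbF => /eqP k0.
  by move/eqP: k1; rewrite k0 mul0r oner_eq0.
by apply: contra_neq b0 => /quad_inj[].
Qed.

Lemma quad_dim : \dim {:L} = 2.
Proof. exact: (size_basis (X := [tuple 1; _]) (quad_basis 0 (oner_neq0 K))). Qed.

Fact rel_trace_is_linear : linear (@rel_trace K L : L -> K^o).
Proof.
move=> k u v; rewrite /rel_trace linearP.
have -> := passmx.mxof_linear (vbasis {:L}) (vbasis {:L}) k (amull u) (amull v).
by rewrite mxtraceD mxtraceZ.
Qed.

(** Multiplication by s squares to the nonsquare scalar D on a space of dimension 2, so s has trace
    0. *)
Lemma rel_trace_quad a b : rel_trace (a%:A + b *: s) = 2%:R * a.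
Proof.
have tr1 : rel_trace (1 : L) = 2%:R.
  rewrite /rel_trace amull1 passmx.mxof1; last exact: basis_free (vbasisP _).
  by rewrite mxtrace1 quad_dim.
have trs : rel_trace s = 0.
  have sqE : passmx.mxof (vbasis {:L}) (vbasis {:L}) (amull s) *m
      passmx.mxof (vbasis {:L}) (vbasis {:L}) (amull s) = D%:M.
    rewrite -passmx.mxof_comp ?vbasisP //.
    have -> : (amull s \o amull s)%VF = D *: \1%VF.
      by apply/lfunP => v; rewrite !lfunE /= !lfunE /= mulrA -expr2 sE -scalerAl mul1r.
    have /eqP e0 : passmx.mxof (vbasis {:L}) (vbasis {:L}) (0 : 'End(L)) == 0.
      by rewrite passmx.mxof_eq0 ?vbasisP.
    have := passmx.mxof_linear (vbasis {:L}) (vbasis {:L}) D \1%VF 0.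
    rewrite addr0 e0 addr0 => ->.
    by rewrite passmx.mxof1 ?scalemx1 //; apply: basis_free (vbasisP _).
  exact: mxtrace_sqrt_scalar quad_dim D_nonsquare sqE.
have /= := rel_trace_is_linear b s (a%:A); rewrite trs scaler0 add0r addrC => ->.
have /= := rel_trace_is_linear a 1 0; rewrite addr0 tr1 => ->.
have /= := rel_trace_is_linear (-1) 0 0; rewrite scaler0 add0r scaleN1r addNr => ->.
by rewrite addr0 mulrC.
Qed.

(** The discriminant 4 D of (1, s) times the square of the determinant of the change of basis. *)
Lemma basis_disc_quad n (e : n.-tuple L) a b a' b' : n = 2 ->
  e = [:: a%:A + b *: s; a'%:A + b' *: s] :> seq L ->
  \det (\matrix_(i, j) rel_trace (tnth e i * tnth e j)) =
  D * (2%:R * (a * b' - a' * b)) ^+ 2.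
Proof.
move=> n2; rewrite {n}n2 in e * => eE.
have e0 : tnth e ord0 = a%:A + b *: s by rewrite (tnth_nth 0) eE.
have e1 : tnth e (lift ord0 ord0) = a'%:A + b' *: s by rewrite (tnth_nth 0) eE.
rewrite (expand_det_row _ ord0) !big_ord_recl big_ord0 /cofactor !det_mx11 !mxE.
rewrite /= !e0.
have -> : lift (lift ord0 ord0) 0 = ord0 :> 'I_2 by exact/val_inj.
have -> : lift ord0 0 = lift ord0 ord0 :> 'I_2 by exact/val_inj.
rewrite !e0 !e1 !quadM !rel_trace_quad /=; ring.
Qed.

(** A basis of integers contributes D x^2 with x in C by [two_coef_wedge]; conversely, for x nonzero
    in C, the basis 1, (y + x s) / 2 has discriminant D x^2. *)
Lemma rel_disc_quad : rel_disc L =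
  ideal_gen [set d | exists2 x, two_coef x & val d = D * x ^+ 2].
Proof.
apply/seteqP; split; apply: ideal_gen_sub (ideal_gen_ideal _) _ => d.
  move=> [e [eb eO dE]]; apply: ideal_gen_mem => /=.
  case eE : (tval e) (size_tuple e) => [|u [|v [|w t]]]; rewrite quad_dim // => _.
  have [a [b uE]] := quad_span u; have [a' [b' vE]] := quad_span v.
  exists (2%:R * (a * b' - a' * b)).
    by apply: two_coef_wedge; rewrite -?uE -?vE eO // memtE eE !inE eqxx ?orbT.
  rewrite dE /basis_disc; apply: basis_disc_quad; first exact: quad_dim.
  by rewrite eE uE vE.
move=> [x [y xyO] dE].
have [x0|x0] := eqVneq x 0.
  suff -> : d = 0 by have [] : is_ideal (rel_disc L) := ideal_gen_ideal _.
  by apply: val_inj; rewrite dE x0 expr0n mulr0 raddf0.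
have x20 : x / 2%:R != 0 by rewrite mulf_neq0 // invr_eq0.
have := quad_basis (y / 2%:R) x20.
set z := _ + _ => zb.
have eS : size [:: 1; z] == \dim {:L} by rewrite quad_dim.
apply: ideal_gen_mem; exists (Tuple eS); split=> //.
  move=> w; rewrite memtE in_cons mem_seq1.
  by move=> /orP[] /eqP ->; [apply: rpred1|apply: xyO].
rewrite /basis_disc dE (@basis_disc_quad _ _ 1 0 (y / 2%:R) (x / 2%:R)) ?quad_dim //=.
  by rewrite mulr0 subr0 mul1r [2%:R * _]mulrC divfK.
by rewrite scale1r scale0r addr0.
Qed.

End Quadratic.

(** * Discrete valuations *)

Section DiscreteValuationTheory.
Variables (F : fieldType) (v : F -> int).
Hypothesis dv : discrete_valuation v.
Implicit Types (x y : F) (m n : int).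

Lemma discrete_valM x y : x != 0 -> y != 0 -> v (x * y) = v x + v y.
Proof. by case: dv => vM _ _; apply: vM. Qed.

Lemma discrete_val1 : v 1 = 0.
Proof.
by apply: (addrI (v 1)); rewrite -discrete_valM ?oner_eq0 // mul1r addr0.
Qed.

Lemma discrete_valX x (n : nat) : x != 0 -> v (x ^+ n) = v x *+ n.
Proof.
move=> x0; elim: n => [|n IHn]; first by rewrite expr0 discrete_val1.
by rewrite exprS discrete_valM ?expf_neq0 // IHn mulrS.
Qed.

Lemma discrete_valV x : x != 0 -> v x^-1 = - v x.
Proof.
move=> x0; apply: (addrI (v x)).
by rewrite -discrete_valM ?invr_eq0 // mulfV // discrete_val1 subrr.
Qed.

Lemma val_geE n x : x != 0 -> val_ge v n x = (n <= v x).
Proof.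
by move=> x0; apply/propext; split=> [[/eqP|//]|]; [rewrite (negPf x0)|right].
Qed.

Lemma val_geS m n x : m <= n -> val_ge v n x -> val_ge v m x.
Proof. by move=> mn [->|nx]; [left|right; apply: le_trans nx]. Qed.

Lemma val_geD n x y : val_ge v n x -> val_ge v n y -> val_ge v n (x + y).
Proof. by case: dv => _ vD _; apply: vD. Qed.

Lemma val_geM m n x y : val_ge v m x -> val_ge v n y -> val_ge v (m + n) (x * y).
Proof.
have [->|x0] := eqVneq x 0; first by rewrite mul0r; left.
have [->|y0] := eqVneq y 0; first by rewrite mulr0; left.
by rewrite !val_geE ?mulf_neq0 // => mx ny; rewrite discrete_valM // lerD.
Qed.

Lemma val_ge0M x y : val_ge v 0 x -> val_ge v 0 y -> val_ge v 0 (x * y).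
Proof. by rewrite -[0 in X in _ -> _ -> X]addr0; apply: val_geM. Qed.

Lemma discrete_valN1 : v (- 1) = 0.
Proof.
have N10 : - 1 != 0 :> F by rewrite oppr_eq0 oner_eq0.
have := discrete_valM N10 N10; rewrite mulrNN mulr1 discrete_val1.
by lia.
Qed.

Lemma val_geN n x : val_ge v n x -> val_ge v n (- x).
Proof.
move=> nx; rewrite -mulN1r -[n]add0r; apply: val_geM => //.
by right; rewrite discrete_valN1.
Qed.

Lemma val_geB n x y : val_ge v n x -> val_ge v n y -> val_ge v n (x - y).
Proof. by move=> nx /val_geN; apply: val_geD. Qed.

End DiscreteValuationTheory.

(** * The completion at q and the exponent of q *)

Section Completion.
Variables (K : fieldExtType rat) (q : nzprime (ringInt K)) (Kq : completion q).
Implicit Types (a b c : ringInt K) (x y z : K).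
Local Notation v := (@cval K q Kq).
Local Notation emb := (@cemb K q Kq).

Let idq : is_ideal q := nzprime_ideal q.
Let dv := cval_discrete Kq.

Lemma emb_eq0 x : (emb x == 0) = (x == 0).
Proof. exact: fmorph_eq0. Qed.

(* That [K] is dense in a field with a nontrivial valuation forces [q] to be   *)
(* invertible: otherwise all the values [ideal_val q (principal a)] vanish.    *)
Lemma ideal_val_principal_neq0 : exists2 b, b != 0 & ideal_val q (principal b) != 0%N.
Proof.
have [x x0 vx] : exists2 x : Kq, x != 0 & v x = 1 by case: dv.
(* Precision 2 exceeds v x = 1, so the approximation is nonzero and has value at least 1. *)
have [a xa] := cemb_dense x 2.
have va : val_ge v 1 (emb a).
  have -> : emb a = x - (x - emb a) by ring.
  by apply: (val_geB dv); [right; rewrite vx|apply: val_geS xa].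
have a0 : a != 0.
  apply: contraTneq isT => a0; move: xa; rewrite a0 rmorph0 subr0.
  by rewrite val_geE // vx.
have [b [c [c0 aE]]] := ringInt_frac a.
have b0 : b != 0.
  by apply: contraNneq a0 => b0; rewrite aE b0 rmorph0 mul0r.
move: va; rewrite aE fmorph_div val_geE; last first.
  by rewrite mulf_neq0 ?invr_eq0 ?emb_eq0 ?ringInt_val_eq0.
rewrite (discrete_valM dv) ?invr_eq0 ?emb_eq0 ?ringInt_val_eq0 //.
rewrite (discrete_valV dv) ?emb_eq0 ?ringInt_val_eq0 // !cval_emb // => vbc.
exists b => //; move: vbc; case: (ideal_val q (principal b)) => // .
by case: (ideal_val q (principal c)).
Qed.

(** This makes q invertible, so that [sub_ideal_dvd] turns containment in a power of q into
    divisibility by it. *)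
Lemma nzprime_dvd_principal : exists2 b, b != 0 & ideal_dvd q (principal b).
Proof.
have [b b0] := ideal_val_principal_neq0; rewrite /ideal_val.
case: xgetP => // n _ [qn _] n0; exists b => //.
rewrite -(idealX1 idq); apply: ideal_dvd_trans qn; apply: idealX_dvd.
by rewrite lt0n.
Qed.

Lemma idealX_dvdP n I : is_ideal I -> ideal_dvd (idealX q n) I <-> I `<=` idealX q n.
Proof.
move=> idI; split; first exact: (ideal_dvd_sub (idealX_ideal q n)).
have [b b0 qb] := nzprime_dvd_principal.
apply: (sub_ideal_dvd (c := b ^+ n)) => //;
  [|exact: idealX_ideal|exact: idealX_dvd_principal].
by apply/lregX/ringInt_lreg.
Qed.

Lemma idealX_principalP n a : ideal_dvd (idealX q n) (principal a) <-> idealX q n a.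
Proof.
split=> [/(idealX_dvdP n (principal_ideal a)) sub|qa].
  by apply: sub; apply: principal_mem.
apply/(idealX_dvdP n (principal_ideal a)).
exact: principal_sub (idealX_ideal q n) qa.
Qed.

(* If [a] lay in every power of [q], its value would be the default [0]; but    *)
(* for [b] in [q ^ n] and not in [q ^ n.+1] with [n > 0], both [b] and [a + b]   *)
(* have value [n], so that the value of [a] is at least [n].                    *)
Lemma idealX_cap a : (forall n, idealX q n a) -> a = 0.
Proof.
move=> qa; apply/eqP/negPn/negP => a0.
have [b b0 vb] := ideal_val_principal_neq0.
have [] : exists n, [/\ ideal_val q (principal b) = n, idealX q n b & ~ idealX q n.+1 b].
  move: vb; rewrite /ideal_val; case: xgetP => // n _ [qn qn1] _.
  by exists n; split=> //; [apply/idealX_principalP|move/idealX_principalP].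
move=> n [vbE qb qb1].
have [_ qD _] := idealX_ideal q n; have [_ qD1 _] := idealX_ideal q n.+1.
have qab1 : ~ idealX q n.+1 (a + b).
  move=> qab; apply: qb1; rewrite -[b](addKr a); apply: qD1 => //.
  exact: (idealN (idealX_ideal q n.+1)).
have ab0 : a + b != 0.
  by apply/eqP => ab0; apply: qab1; rewrite ab0; case: (idealX_ideal q n.+1).
have vab : ideal_val q (principal (a + b)) = n.
  apply: ideal_val_unique; first by apply/idealX_principalP/qD.
  by move/idealX_principalP.
have va : ideal_val q (principal a) = 0%N.
  apply: xgetPN => m [_]; apply.
  exact/idealX_principalP.
have : val_ge v n%:Z (emb (val a)).
  have -> : emb (val a) = emb (val (a + b)) - emb (val b).
    by rewrite -rmorphB -rmorphB addrK.
  by apply: (val_geB dv); right; rewrite cval_emb // ?vab ?vbE.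
rewrite val_geE; last by rewrite emb_eq0 ringInt_val_eq0.
by rewrite cval_emb // va; move: vb; rewrite vbE; lia.
Qed.

(** By [idealX_cap] some power of q does not contain I, so [ideal_val] is a true exponent and not
    the default. *)
Lemma ideal_val_spec I : is_ideal I -> I <> [set 0] ->
  I `<=` idealX q (ideal_val q I) /\ ~ I `<=` idealX q (ideal_val q I).+1.
Proof.
move=> idI I0; have [n In] : exists n, ~ I `<=` idealX q n.
  apply: contra_notP I0 => /forallNP In; apply/seteqP; split=> [a Ia|_ ->].
    by apply: idealX_cap => n; have /contrapT := In n; apply.
  by case: idI.
have [|/(idealX_dvdP n idI)//|d nd] := @ideal_valP _ q I n.
  exact/idealX_dvdP.
by split; [apply/idealX_dvdP|move/(idealX_dvdP _ idI)].
Qed.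

Lemma val_ge_idealX n a : val_ge v n%:Z (emb (val a)) <-> idealX q n a.
Proof.
have [->|a0] := eqVneq a 0.
  by rewrite !rmorph0; split=> _; [case: (idealX_ideal q n)|left].
rewrite val_geE ?emb_eq0 ?ringInt_val_eq0 // cval_emb // lez_nat.
have [sub nsub] := ideal_val_spec (principal_ideal a) (principal_neq0 a0).
split=> [le|qa].
  apply: (ideal_dvd_sub (idealX_ideal _ _) (idealX_dvd q le)).
  by apply: sub; apply: principal_mem.
rewrite leqNgt; apply/negP => lt; apply: nsub.
apply: principal_sub; first exact: idealX_ideal.
exact: (ideal_dvd_sub (idealX_ideal _ _) (idealX_dvd q lt)).
Qed.

Lemma val_ge_ringInt a : val_ge v 0 (emb (val a)).
Proof. exact/(val_ge_idealX 0). Qed.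

(** Such a z lies in the localization at q. Write z = b / c and (c) = q^k J with k the value of c.
    Then J is not inside q, and for r in J outside q the product b r lies in q^k J = (c). *)
Lemma val_ge0_denominator z : val_ge v 0 (emb z) ->
  exists2 r, ~ nzprime_set q r & val r * z \in int_pred K.
Proof.
have [b [c [c0 ->]]] := ringInt_frac z.
have [->|b0] := eqVneq b 0.
  move=> _; exists 1; first exact: nzprime_proper.
  by rewrite rmorph0 mul0r mulr0 rpred0.
have [emb_b emb_c] : emb (val b) != 0 /\ emb (val c) != 0.
  by rewrite !emb_eq0 !ringInt_val_eq0.
rewrite fmorph_div val_geE ?mulf_neq0 ?invr_eq0 //.
rewrite (discrete_valM dv) ?invr_eq0 // (discrete_valV dv) // subr_ge0 => vcb.
have [sub nsub] := ideal_val_spec (principal_ideal c) (principal_neq0 c0).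
have vc : v (emb (val c)) = (ideal_val q (principal c))%:Z by rewrite cval_emb.
set k := ideal_val _ _ in sub nsub vc.
have [J idJ cE] : ideal_dvd (idealX q k) (principal c).
  exact/(idealX_dvdP k (principal_ideal c)).
have [r Jr qr] : exists2 r, J r & ~ nzprime_set q r.
  apply: contra_notP nsub => /forall2NP Jq; rewrite cE idealXS idealMC.
  by apply: idealMS => // r Jr; have [//|/contrapT] := Jq r.
have [t tE] : exists t, b * r = c * t.
  apply/principalP; rewrite cE; apply: idealM_mem => //.
  by apply/val_ge_idealX; right; rewrite -vc.
exists r => //; suff -> : val r * (val b / val c) = val t by apply: valP.
by rewrite mulrA -rmorphM mulrC [r * b]mulrC tE rmorphM mulKf ?ringInt_val_eq0.
Qed.

Lemma ideal_val_attained I : is_ideal I -> I <> [set 0] ->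
  exists2 a, I a & a != 0 /\ v (emb (val a)) = (ideal_val q I)%:Z.
Proof.
move=> idI I0; have [sub /existsNP[a /not_implyP[Ia qa]]] := ideal_val_spec idI I0.
have a0 : a != 0.
  apply/eqP => a0; apply: qa; rewrite a0.
  by case: (idealX_ideal q (ideal_val q I).+1).
exists a => //; split=> //; have e0 : emb (val a) != 0.
  by rewrite emb_eq0 ringInt_val_eq0.
have /val_ge_idealX := sub _ Ia; rewrite val_geE // => le.
apply/eqP; rewrite eq_le le andbT leNgt; apply/negP => lt; apply: qa.
by apply/val_ge_idealX; right; rewrite -addn1 PoszD lezD1.
Qed.

End Completion.

(** * The ideal S as the inverse of C, and the local congruences *)

Section Conductor.
Variables (K : fieldExtType rat) (L : fieldExtType K) (s : L) (d : ringInt K).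
Hypothesis sE : s ^+ 2 = (val d)%:A.
Hypothesis d_nonsquare : forall c : K, c ^+ 2 != val d.
Hypothesis quad_span : forall x : L, exists a b : K, x = a%:A + b *: s.
Variable S : set (ringInt K).
Hypothesis idS : is_ideal S.
Hypothesis SE : idealM (idealX S 2) (rel_disc L) = principal d.
Implicit Types (a b c t : ringInt K) (x y : K) (I J P : set (ringInt K)).

Let two0 := two_neq0 K.
Local Notation C := (two_coef s).

Let d0 : val d != 0.
Proof. by have := d_nonsquare 0; rewrite expr0n eq_sym. Qed.

Let dreg : GRing.lreg d.
Proof. by apply: ringInt_lreg; rewrite -ringInt_val_eq0. Qed.

Let rel_discE := rel_disc_quad two0 sE d_nonsquare quad_span.

(** As d (a x)^2 = a^2 (d x^2) lies in S^2 Disc = (d), the square of a x is integral, hence so is a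
    x. *)
Lemma conductor_mul_int a x : S a -> C x -> val a * x \in int_pred K.
Proof.
move=> Sa Cx; apply: int_pred_sqr.
have [e eE] := ringIntE (two_coef_int two0 sE d_nonsquare Cx).
have : principal d (a * a * e).
  rewrite -SE; apply: idealM_mem; first by rewrite idealX2 //; apply: idealM_mem.
  by rewrite rel_discE; apply: ideal_gen_mem; exists x.
move=> /principalP[t /(congr1 val)]; rewrite !ringIntM eE => tE.
suff -> : (val a * x) ^+ 2 = val t by apply: valP.
by apply: (mulfI d0); rewrite -tE; ring.
Qed.

(** The products a x generate the unit ideal: a b (d x^2) = d (a x) (b x) puts S^2 Disc = (d) inside
    d P. *)
Lemma conductor_coef_unit P : is_ideal P ->
  (forall a x t, S a -> C x -> val t = val a * x -> P t) -> P 1.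
Proof.
move=> idP SCP; have idQ := ideal_quot 1 d idP.
set Q := [set u | _] in idQ.
suff sub : idealM (idealX S 2) (rel_disc L) `<=` Q.
  have [|t] := sub d; first by rewrite SE; apply: principal_mem.
  by rewrite mul1r -{1}[d]mulr1 => /dreg <-.
apply: idealM_sub => // u y Su; move: y; rewrite rel_discE.
apply: ideal_gen_sub; first exact: (ideal_colon u idQ).
move=> y [x Cx yE] /=; rewrite mulrC; move: u Su; rewrite idealX2 //.
apply: idealM_sub; first exact: (ideal_colon y idQ).
move=> a b Sa Sb /=.
have [t tE] := ringIntE (conductor_mul_int Sa Cx).
have [w wE] := ringIntE (conductor_mul_int Sb Cx).
exists (t * w); last by case: idP => _ _; apply; apply: SCP wE.
apply: val_inj; rewrite mul1r !ringIntM yE tE wE; ring.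
Qed.

Lemma two_coef_ideal x : is_ideal [set r : ringInt K | C (val r * x)].
Proof.
have C0 : C 0 by exists 0; rewrite mul0r !scale0r addr0 rpred0.
split=> [|a b Ca Cb|a b Cb]; rewrite /mkset.
- by rewrite ringInt0 mul0r.
- by rewrite ringIntD mulrDl; apply: two_coefD.
- by rewrite ringIntM -mulrA; apply: two_coefM => //; apply: valP.
Qed.

(* In terms of fractional ideals, [S] is the inverse of [two_coef s], so that  *)
(* [I | S] iff the inverse of [I] lies in [two_coef s].                        *)
Lemma dvd_conductorP c I : c != 0 -> is_ideal I -> ideal_dvd I (principal c) ->
  ideal_dvd I S <->
  (forall x, (forall a, I a -> val a * x \in int_pred K) -> C x).
Proof.
move=> c0 idI Ic; split=> [IS x Ix|IC].
  rewrite -[x]mul1r -ringInt1.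
  (* Here (a y) x = (a x) y, and a x is integral because a is in S, which is contained in I. *)
  apply: (conductor_coef_unit (two_coef_ideal x)) => a y t Sa Cy tE /=.
  rewrite tE mulrAC; apply: two_coefM => //.
  by apply: Ix; apply: (ideal_dvd_sub idI IS).
apply: (sub_ideal_dvd (ringInt_lreg c0) idI idS Ic) => a Sa.
have [J idJ cE] := Ic.
have sub : idealM I J `<=` [set u | exists2 t, a * u = c * t & I t].
  apply: idealM_sub => [|b j Ib Jj]; first exact: ideal_quot.
  (* Since I J = (c), the quotients j / c lie in the inverse of I. *)
  have Cj : C (val j / val c).
    apply: IC => b' Ib'.
    have /principalP[t tE] : principal c (b' * j).
      by rewrite cE; apply: idealM_mem.
    suff -> : val b' * (val j / val c) = val t by apply: valP.
    by rewrite mulrA -ringIntM tE ringIntM mulrAC mulfV ?mul1r ?ringInt_val_eq0.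
  have [t tE] := ringIntE (conductor_mul_int Sa Cj).
  exists (b * t); last by rewrite mulrC; case: idI => _ _; apply.
  apply: val_inj; rewrite !ringIntM tE.
  by field; rewrite ringInt_val_eq0.
have [|t + It] := sub c; first by rewrite -cE; apply: principal_mem.
by rewrite mulrC => /(ringInt_lreg c0) ->.
Qed.

Lemma dvd_conductor_principal I : is_ideal I -> ideal_dvd I S ->
  ideal_dvd (idealX I 2) (principal d).
Proof.
move=> idI [J idJ SIJ]; rewrite -SE SIJ idealM_sqr // -idealMA.
exact/ideal_dvd_mulr/idealM_ideal.
Qed.

(** * The congruence modulo 4 at one prime *)

Section Local.
Variables (q : nzprime (ringInt K)) (Kq : completion q) (pi : Kq).
Hypothesis pi_unif : uniformizer pi.
Local Notation v := (@cval K q Kq).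
Local Notation emb := (@cemb K q Kq).
Let dv := cval_discrete Kq.

Definition square_mod4 (n : nat) : Prop := exists y z : Kq, [/\ cint y, cint z &
  emb (val d) / pi ^+ (2 * n) - y ^+ 2 = 4%:R * z].

(** With (c) = I J, the products a (j / c) generate the unit ideal, so one of them avoids q and has
    value 0; its factor j / c is the required x. *)
Lemma inverse_val c I : c != 0 -> is_ideal I -> I <> [set 0] ->
    ideal_dvd I (principal c) ->
  exists x, [/\ x != 0, forall a, I a -> val a * x \in int_pred K &
    v (emb x) = - (ideal_val q I)%:Z].
Proof.
move=> c0 idI I0 [J idJ cE].
have vc0 : val c != 0 by rewrite ringInt_val_eq0.
have [a Ia [j Jj [t tE qt]]] : exists2 a, I a & exists2 j, J j &
    exists2 t, a * j = c * t & ~ nzprime_set q t.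
  apply: contrapT => noq; apply: (@nzprime_proper _ q).
  have sub : idealM I J `<=` [set u | exists2 t, 1 * u = c * t & nzprime_set q t].
    apply: idealM_sub => [|a j Ia Jj]; first exact/ideal_quot/nzprime_ideal.
    have /principalP[t tE] : principal c (a * j) by rewrite cE; apply: idealM_mem.
    exists t; rewrite ?mul1r //; apply: contrapT => qt; apply: noq.
    by exists a => //; exists j => //; exists t.
  have [|t] := sub c; first by rewrite -cE; apply: principal_mem.
  by rewrite mul1r -{1}[c]mulr1 => /(ringInt_lreg c0) <-.
have t0 : t != 0 by apply/eqP => t0; apply: qt; rewrite t0; case: (nzprime_ideal q).
have ax : val a * (val j / val c) = val t.
  by rewrite mulrA -ringIntM tE ringIntM mulrAC mulfV ?mul1r.
have ax0 : val a * (val j / val c) != 0 by rewrite ax ringInt_val_eq0.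
have xI b : I b -> val b * (val j / val c) \in int_pred K.
  move=> Ib; have /principalP[w wE] : principal c (b * j).
    by rewrite cE; apply: idealM_mem.
  suff -> : val b * (val j / val c) = val w by apply: valP.
  by rewrite mulrA -ringIntM wE ringIntM mulrAC mulfV ?mul1r.
set x := val j / val c in ax ax0 xI *.
move: ax0; rewrite mulf_eq0 negb_or => /andP[a0 x0].
exists x; split=> //.
have ea0 : emb (val a) != 0 by rewrite emb_eq0.
have ex0 : emb x != 0 by rewrite emb_eq0.
have vt : v (emb (val a)) + v (emb x) = 0.
  rewrite -(discrete_valM dv) // -rmorphM ax.
  have et0 : emb (val t) != 0 by rewrite emb_eq0 ringInt_val_eq0.
  have := val_ge_ringInt Kq t; rewrite val_geE // => vt.
  apply/eqP; rewrite eq_le vt andbT leNgt; apply/negP => vt1; apply: qt.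
  by rewrite -(idealX1 (nzprime_ideal q)); apply/(val_ge_idealX Kq); right.
(* Integrality of b x bounds the value of x below; v a >= val_q(I) together with v a + v x = 0
   bounds it above. *)
have [b Ib [b0 vb]] := ideal_val_attained Kq idI I0.
have [sub _] := ideal_val_spec Kq idI I0.
have := sub _ Ia; move/(val_ge_idealX Kq); rewrite val_geE // => va.
have [w wE] := ringIntE (xI b Ib).
have := val_ge_ringInt Kq w; rewrite wE rmorphM val_geE; last first.
  by apply: mulf_neq0 => //; rewrite emb_eq0 ringInt_val_eq0; apply: b0.
rewrite (discrete_valM dv) ?emb_eq0 ?ringInt_val_eq0 // vb.
move: va vt; set n := (_ I)%:Z; lia.
Qed.

Let pi0 : pi != 0. Proof. by case: pi_unif. Qed.

Let vpiX n : v (pi ^+ n) = n%:Z.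
Proof. by rewrite (discrete_valX dv) //; case: pi_unif => _ ->; rewrite natz. Qed.

(** Since u = x pi^n is a unit, y^2 - d x^2 = 4 b can be divided by u^2. *)
Lemma two_coef_square_mod4 n x : x != 0 -> v (emb x) = - n%:Z -> C x ->
  square_mod4 n.
Proof.
move=> x0 vx /(two_coefP two0 sE d_nonsquare)[y yO nm].
have [a aE] := ringIntE yO; have [b bE] := ringIntE nm.
have ex0 : emb x != 0 by rewrite emb_eq0.
have four0 := four_neq0 two0.
pose u := emb x * pi ^+ n.
have u0 : u != 0 by rewrite mulf_neq0 // expf_neq0.
have vu : val_ge v 0 u^-1.
  rewrite val_geE ?invr_eq0 // (discrete_valV dv) // (discrete_valM dv) ?expf_neq0 //.
  by rewrite vx vpiX addNr.
have wE : emb (val b) = (emb y ^+ 2 - emb (val d) * emb x ^+ 2) / 4%:R.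
  by rewrite bE fmorph_div rmorphB 2!(rmorphXn, rmorphM) rmorphXn rmorph_nat.
exists (emb y / u), (- emb (val b) / u ^+ 2); split.
- by apply: (val_ge0M dv) => //; rewrite -aE; apply: val_ge_ringInt.
- rewrite /cint /= -exprVn expr2; apply: (val_ge0M dv); last exact: (val_ge0M dv).
  by apply: (val_geN dv); apply: val_ge_ringInt.
- have p0 : pi ^+ n != 0 by rewrite expf_neq0.
  have e40 : 4%:R != 0 :> Kq by rewrite -(rmorph_nat emb) emb_eq0.
  rewrite wE mulnC exprM /u; move: (pi ^+ n) p0 => p p0.
  by field; rewrite e40 p0 ex0.
Qed.

(** Multiplied by u^2, for u = x pi^n, the congruence says that d x^2 is the square of u y modulo 4.
    Replacing u y by a close w in K, it remains to clear the denominators of w and of (d x^2 - w^2)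
    / 4 by elements outside q. *)
Lemma square_mod4_denominator n x : val d * x ^+ 2 \in int_pred K ->
    val_ge v (- n%:Z) (emb x) -> square_mod4 n ->
  exists2 r, ~ nzprime_set q r & C (val r * x).
Proof.
move=> dx vx [y [z [yO zO yzE]]].
have four0 := four_neq0 two0.
have e40 : 4%:R != 0 :> Kq by rewrite -(rmorph_nat emb) emb_eq0.
pose u := emb x * pi ^+ n.
have vu : val_ge v 0 u.
  rewrite -[0](addNr n%:Z); apply: (val_geM dv) => //.
  by rewrite val_geE ?vpiX ?expf_neq0.
have dxE : emb (val d) * emb x ^+ 2 = (u * y) ^+ 2 + 4%:R * (u ^+ 2 * z).
  have p0 : pi ^+ n != 0 by rewrite expf_neq0.
  transitivity (u ^+ 2 * (emb (val d) / pi ^+ (2 * n))).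
    rewrite /u mulnC exprM; move: (pi ^+ n) p0 => p p0; field; exact: p0.
  have -> : emb (val d) / pi ^+ (2 * n) = y ^+ 2 + 4%:R * z.
    by rewrite -yzE addrC subrK.
  ring.
(* Precision v 4 suffices, as (u y)^2 - w^2 = (u y - w) (u y + w) with an integral second factor. *)
have [w yw] := cemb_dense (u * y) (v 4%:R).
have v4 : 0 <= v 4%:R.
  rewrite -(val_geE v _ e40); have := val_ge_ringInt Kq 4%:R.
  by rewrite !rmorph_nat.
have vw : val_ge v 0 (emb w).
  have -> : emb w = u * y - (u * y - emb w) by ring.
  apply: (val_geB dv); first exact: (val_ge0M dv).
  exact: val_geS yw.
pose g := (val d * x ^+ 2 - w ^+ 2) / 4%:R.
have vg : val_ge v 0 (emb g).
  have -> : emb g = u ^+ 2 * z + (u * y - emb w) * 4%:R^-1 * (u * y + emb w).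
    rewrite /g fmorph_div rmorphB 2!(rmorphXn, rmorphM) rmorphXn rmorph_nat dxE.
    by field.
  have v4V : val_ge v (- v 4%:R) (4%:R^-1 : Kq).
    by rewrite val_geE ?invr_eq0 // (discrete_valV dv).
  apply: (val_geD dv).
    by rewrite expr2; do 2?apply: (val_ge0M dv).
  apply: (val_ge0M dv).
    by rewrite -[0](subrr (v 4%:R)); apply: (val_geM dv).
  by apply: (val_geD dv) => //; apply: (val_ge0M dv).
have [r1 qr1 r1w] := val_ge0_denominator vw.
have [r2 qr2 r2g] := val_ge0_denominator vg.
exists (r1 * r2); first by case/nzprime_prime.
apply/(two_coefP two0 sE d_nonsquare); exists (val r2 * (val r1 * w)).
  by rewrite rpredM // (valP r2).
have -> : ((val r2 * (val r1 * w)) ^+ 2 - val d * (val (r1 * r2) * x) ^+ 2) / 4%:R =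
    - (val r1 ^+ 2 * val r2 * (val r2 * g)).
  by rewrite ringIntM /g; field.
by rewrite rpredN rpredM // rpredM ?rpredX // ?(valP r1) ?(valP r2).
Qed.

End Local.

Lemma square_mod4_sub_two_coef (Kq : forall q, completion q)
    (pi : forall q, Kq q) (pi_unif : forall q, uniformizer (pi q)) I :
    is_ideal I -> I <> [set 0] -> ideal_dvd (idealX I 2) (principal d) ->
    (forall q : nzprime (ringInt K), nzprime_set q 2%:R ->
      square_mod4 (pi q) (ideal_val q I)) ->
  forall x, (forall a, I a -> val a * x \in int_pred K) -> C x.
Proof.
move=> idI I0 I2d Isq x xI.
have dx : val d * x ^+ 2 \in int_pred K.
  have idP : is_ideal [set t : ringInt K | val t * x ^+ 2 \in int_pred K].
    split=> [|a b aP bP|a b bP]; rewrite /mkset.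
    - by rewrite ringInt0 mul0r rpred0.
    - by rewrite ringIntD mulrDl rpredD.
    - by rewrite ringIntM -mulrA rpredM // (valP a).
  suff sub : idealX I 2 `<=` [set t : ringInt K | val t * x ^+ 2 \in int_pred K].
    apply: sub; apply: (ideal_dvd_sub (idealX_ideal I 2) I2d).
    exact: principal_mem.
  rewrite idealX2 //; apply: idealM_sub => // a b Ia Ib; rewrite /mkset.
  have -> : val (a * b) * x ^+ 2 = val a * x * (val b * x) by rewrite ringIntM; ring.
  by rewrite rpredM ?xI.
have idP := two_coef_ideal x.
suff : [set r : ringInt K | C (val r * x)] 1 by rewrite /mkset ringInt1 mul1r.
(* The witness y = 0 reduces this to integrality of d x^2; so a prime containing all r with r x in C
   is above 2. *)
have P2 : C (val (2%:R : ringInt K) * x).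
  apply/(two_coefP two0 sE d_nonsquare); exists 0; first exact: rpred0.
  suff -> : (0 ^+ 2 - val d * (val (2%:R : ringInt K) * x) ^+ 2) / 4%:R =
      - (val d * x ^+ 2) by rewrite rpredN.
  by rewrite rmorph_nat; field; apply: four_neq0 two0.
apply: contrapT => P1.
have [|q Pq] := nzprime_exists idP _ P1.
  move=> P0; have : [set r : ringInt K | C (val r * x)] 2%:R by [].
  rewrite P0 => /(congr1 val); rewrite rmorph_nat ringInt0 => /eqP.
  by rewrite (negPf two0).
have [a Ia [a0 va]] := ideal_val_attained (Kq q) idI I0.
have vx : val_ge (@cval K q (Kq q)) (- (ideal_val q I)%:Z) (cemb (Kq q) x).
  have [->|x0] := eqVneq x 0; first by rewrite rmorph0; left.
  have [t tE] := ringIntE (xI a Ia).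
  have va0 : val a != 0 by rewrite ringInt_val_eq0; apply: a0.
  have := val_ge_ringInt (Kq q) t; rewrite tE rmorphM !val_geE ?mulf_neq0 ?emb_eq0 //.
  by rewrite (discrete_valM (cval_discrete _)) ?emb_eq0 // va -lerBlDl sub0r.
have [r qr Cr] := square_mod4_denominator (pi_unif q) dx vx (Isq q (Pq _ P2)).
exact: qr (Pq r Cr).
Qed.

Lemma dvd_conductor_square_mod4 (Kq : forall q, completion q)
    (pi : forall q, Kq q) (pi_unif : forall q, uniformizer (pi q)) I :
    is_ideal I -> I <> [set 0] ->
  ideal_dvd I S <-> ideal_dvd (idealX I 2) (principal d) /\
    forall q : nzprime (ringInt K), nzprime_set q 2%:R ->
      square_mod4 (pi q) (ideal_val q I).
Proof.
move=> idI I0; have dn0 : d != 0 by rewrite -ringInt_val_eq0.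
(* Dividing the nonzero principal ideal (d) is what makes I invertible, in both directions. *)
have dvdI : ideal_dvd (idealX I 2) (principal d) -> ideal_dvd I (principal d).
  apply: ideal_dvd_trans; rewrite -{1}(idealX1 idI); exact: idealX_dvd.
split=> [IS|[I2d Isq]]; last first.
  apply/(dvd_conductorP dn0 idI (dvdI I2d)).
  exact: (square_mod4_sub_two_coef pi_unif idI I0 I2d Isq).
have I2d := dvd_conductor_principal idI IS; split=> // q _.
have [x [x0 xI vx]] := inverse_val (Kq q) dn0 idI I0 (dvdI I2d).
apply: (two_coef_square_mod4 (pi_unif q) x0 vx).
exact: (dvd_conductorP dn0 idI (dvdI I2d)).1 IS x xI.
Qed.

End Conductor.

(** * The square root 2 theta - tau of the discriminant of gamma *)

Section Eigenvalue.
Variables (K : fieldType) (gamma : 'M[K]_2) (L : fieldExtType K) (theta : L).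
Hypothesis two0 : 2%:R != 0 :> K.
Hypothesis thetaP : adjoins_eigenvalue gamma theta.

Lemma char_poly2 : char_poly gamma = 'X^2 - (\tr gamma)%:P * 'X + (\det gamma)%:P.
Proof.
apply/polyP => i; rewrite coefD coefB coefXn coefCM coefX coefC.
have sz := size_char_poly gamma; case: i => [|[|[|i]]] /=.
- by rewrite char_poly_det sqrrN expr1n mul1r; ring.
- by rewrite (char_poly_trace gamma) //; ring.
- have := char_poly_monic gamma; rewrite monicE lead_coefE sz => /eqP ->; ring.
- by rewrite nth_default ?sz //; ring.
Qed.

Lemma eigenvalue_root : theta ^+ 2 = (\tr gamma)%:A * theta - (\det gamma)%:A.
Proof.
have [+ _] := thetaP; rewrite char_poly2 /root rmorphD rmorphB /= map_polyXn.
rewrite rmorphM /= map_polyX !map_polyC /= !hornerE.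
by rewrite -addrA addr_eq0 opprD opprK => /eqP.
Qed.

Lemma eigenvalue_sqr : (theta *+ 2 - (\tr gamma)%:A) ^+ 2 =
  ((\tr gamma) ^+ 2 - 4%:R * \det gamma)%:A.
Proof.
have -> : ((\tr gamma) ^+ 2 - 4%:R * \det gamma)%:A =
    (\tr gamma)%:A ^+ 2 - 4%:R * (\det gamma)%:A :> L.
  rewrite -[LHS]/(in_alg L _) rmorphB rmorphXn rmorphM rmorph_nat.
  by [].
have -> : (\det gamma)%:A = (\tr gamma)%:A * theta - theta ^+ 2.
  by rewrite eigenvalue_root opprB addrC subrK.
by ring.
Qed.

(** A square root c of the discriminant would give the root (tau + c) / 2 in K, hence a linear
    factor. *)
Lemma disc_nonsquare : irreducible_poly (char_poly gamma) ->
  forall c, c ^+ 2 != (\tr gamma) ^+ 2 - 4%:R * \det gamma.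
Proof.
move=> [_ irr] c; apply/eqP => cE; pose r := (\tr gamma + c) / 2%:R.
have : 'X - r%:P %| char_poly gamma.
  rewrite dvdp_XsubCl /root char_poly2 !hornerE; apply/eqP.
  have -> : \det gamma = (\tr gamma ^+ 2 - c ^+ 2) / 4%:R.
    by rewrite cE; field; apply: four_neq0.
  by rewrite /r /=; field; rewrite two0 four_neq0.
move=> /irr; rewrite size_XsubC => /(_ isT)/eqp_size.
by rewrite size_XsubC size_char_poly.
Qed.

Lemma eigenvalue_span x : exists a b,
  x = a%:A + b *: (theta *+ 2 - (\tr gamma)%:A).
Proof.
have [root1 full] := thetaP.
have : x \in <<1; theta>>%VS by rewrite full memvf.
case/Fadjoin_polyP => p /polyOver1P[{}p ->] ->.
have [u [v ->]] : exists u v, (map_poly (in_alg L) p).[theta] = u%:A + v *: theta.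
  elim/poly_ind: p => [|p c [u [v IH]]].
    by exists 0, 0; rewrite rmorph0 horner0 !scale0r addr0.
  exists (c - v * \det gamma), (u + v * \tr gamma).
  rewrite rmorphD rmorphM /= map_polyX map_polyC /= hornerMXaddC IH.
  rewrite mulrDl -!scalerAl mul1r -expr2 eigenvalue_root scalerBr !scalerDl.
  by rewrite -scalerAl mul1r !scalerA scaleNr; ring.
exists (u + v * \tr gamma / 2%:R), (v / 2%:R).
rewrite scalerBr -scaler_nat !scalerA divfK // [v * _ / _]mulrAC scalerDl.
by rewrite -addrA [X in _ = _ + X]addrC subrK.
Qed.

End Eigenvalue.

Unset Implicit Arguments.
Set Strict Implicit.

Theorem proposition9 (K : fieldExtType rat) (gamma : 'M[K]_2)
    (gamma_unit : gamma \in unitmx)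
    (gamma_elliptic : irreducible_poly (char_poly gamma))
    (tau delta : ringInt K)
    (tauE : val tau = \tr gamma) (deltaE : val delta = \det gamma)
    (Kgamma : fieldExtType K) (theta : Kgamma)
    (KgammaE : adjoins_eigenvalue gamma theta)
    (Sgamma : set (ringInt K)) (Sgamma_ideal : is_ideal Sgamma)
    (SgammaE : idealM (idealX Sgamma 2) (rel_disc Kgamma) =
               principal (tau ^+ 2 - 4%:R * delta))
    (Kq : forall q : nzprime (ringInt K), completion q)
    (pi : forall q : nzprime (ringInt K), Kq q)
    (pi_unif : forall q : nzprime (ringInt K), uniformizer (pi q))
    (I : set (ringInt K)) (I_ideal : is_ideal I) (I_neq0 : I <> [set 0]) :
  ideal_dvd I Sgamma <->
  (ideal_dvd (idealX I 2) (principal (tau ^+ 2 - 4%:R * delta)) /\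
   forall q : nzprime (ringInt K), nzprime_set q 2%:R ->
     exists y z : Kq q, [/\ cint y, cint z &
       cemb (Kq q) (val (tau ^+ 2 - 4%:R * delta)) / pi q ^+ (2 * ideal_val q I)
         - y ^+ 2 = 4%:R * z]).
Proof.
have dE : val (tau ^+ 2 - 4%:R * delta) = \tr gamma ^+ 2 - 4%:R * \det gamma.
  by rewrite rmorphB rmorphXn rmorphM rmorph_nat -tauE -deltaE.
apply: (dvd_conductor_square_mod4 (s := theta *+ 2 - (\tr gamma)%:A)) => //.
- by rewrite dE; apply: eigenvalue_sqr.
- by rewrite dE; apply: disc_nonsquare gamma_elliptic; apply: two_neq0.
- exact: (eigenvalue_span (two_neq0 K) KgammaE).
Qed.
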